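(* Let $\big\{(U^k,V^k,\widehat{U}^{k},\widehat{V}^{k},\overline{U}^{k},\overline{V}^{k})\big\}_{k\in\mathbb{N}}$ be generated by the majorized alternating proximal (MAP) method (described in the context) for minimizing $\Phi_{\lambda,\mu}$. Then: (i) for each $k\in\mathbb{N}$, $$\begin{aligned}\Phi_{\lambda,\mu}(\overline{U}^{k},\overline{V}^{k})&\ge\Phi_{\lambda,\mu}(\widehat{U}^{k+1},\widehat{V}^{k+1})+\frac{\gamma_{1,k}}{2}\|U^{k+1}-\overline{U}^k\|_F^2\\&\ge\Phi_{\lambda,\mu}(\overline{U}^{k+1},\overline{V}^{k+1})+\frac{\gamma_{1,k}}{2}\|U^{k+1}-\overline{U}^k\|_F^2+\frac{\gamma_{2,k}}{2}\|V^{k+1}-\widehat{V}^{k+1}\|_F^2,\end{aligned}$$ and hence $\{\Phi_{\lambda,\mu}(\overline{U}^k,\overline{V}^k)\}_{k\in\mathbb{N}}$ and $\{\Phi_{\lambda,\mu}(\widehat{U}^k,\widehat{V}^k)\}_{k\in\mathbb{N}}$ are nonincreasing and convergent; (ii) the sequence $\big\{(U^k,V^k,\widehat{U}^{k},\widehat{V}^{k},\overline{U}^{k},\overline{V}^{k})\big\}_{k\in\mathbb{N}}$ is bounded; (iii) there exists $\overline{k}\in\mathbb{N}$ such that for all $k\ge\overline{k}$, $$J_{V^{k}}=J_{U^{k}}=J_{\widehat{U}^{k}}=J_{\widehat{V}^{k}}=J_{\overline{V}^{k}}=J_{\overline{U}^{k}}=J_{\overline{U}^{k+1}}.$$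
   Context: Setting: $n\le m$, $1\le r\le n$; $f:\mathbb{R}^{n\times m}\to\mathbb{R}_+$ is smooth with $\nabla f$ Lipschitz of modulus $L_f$; $\lambda,\mu>0$. $\|Z\|_{2,0}$ is the number of nonzero columns of $Z$ and $J_Z$ is the index set of nonzero columns of $Z$. $\Phi_{\lambda,\mu}(U,V)=f(UV^{\mathbb{T}})+\frac{\mu}{2}(\|U\|_F^2+\|V\|_F^2)+\lambda(\|U\|_{2,0}+\|V\|_{2,0})$ on $\mathbb{R}^{n\times r}\times\mathbb{R}^{m\times r}$, and $$\widehat{\Phi}_{\lambda,\mu}(U,V,G,H)=f(GH^{\mathbb{T}})+\langle\nabla f(GH^{\mathbb{T}}),UV^{\mathbb{T}}-GH^{\mathbb{T}}\rangle+\tfrac{L_f}{2}\|UV^{\mathbb{T}}-GH^{\mathbb{T}}\|_F^2+\tfrac{\mu}{2}(\|U\|_F^2+\|V\|_F^2)+\lambda(\|U\|_{2,0}+\|V\|_{2,0}).$$ $\mathbb{O}^{n\times k}$ is the set of $n\times k$ matrices with orthonormal columns and $\mathbb{O}^{r}=\mathbb{O}^{r\times r}$. MAP method: choose $\varrho\in(0,1)$, $\underline{\gamma_1},\underline{\gamma_2},\gamma_{1,0},\gamma_{2,0}>0$, $P^0\in\mathbb{O}^{m\times r}$, $Q^0\in\mathbb{O}^{n\times r}$, $D^0=I_r$; set $\overline{U}^0=Q^0$, $\overline{V}^0=P^0$. For $k=0,1,2,\dots$: 1. choose $U^{k+1}\in\arg\min_{U\in\mathbb{R}^{n\times r}}\{\widehat{\Phi}_{\lambda,\mu}(U,\overline{V}^k,\overline{U}^k,\overline{V}^k)+\frac{\gamma_{1,k}}{2}\|U-\overline{U}^k\|_F^2\}$;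 2. take a (thin) SVD $U^{k+1}D^k=\widehat{P}^{k+1}(\widehat{D}^{k+1})^2(\widehat{Q}^{k+1})^{\mathbb{T}}$, and set $\widehat{U}^{k+1}:=\widehat{P}^{k+1}\widehat{D}^{k+1}$, $\widehat{V}^{k+1}:=P^k\widehat{Q}^{k+1}\widehat{D}^{k+1}$; 3. choose $V^{k+1}\in\arg\min_{V\in\mathbb{R}^{m\times r}}\{\widehat{\Phi}_{\lambda,\mu}(\widehat{U}^{k+1},V,\widehat{U}^{k+1},\widehat{V}^{k+1})+\frac{\gamma_{2,k}}{2}\|V-\widehat{V}^{k+1}\|_F^2\}$; 4. take a (thin) SVD $V^{k+1}\widehat{D}^{k+1}=P^{k+1}(D^{k+1})^2(Q^{k+1})^{\mathbb{T}}$, and set $\overline{U}^{k+1}:=\widehat{P}^{k+1}Q^{k+1}D^{k+1}$, $\overline{V}^{k+1}:=P^{k+1}D^{k+1}$; 5. set $\gamma_{1,k+1}=\max(\underline{\gamma_1},\varrho\gamma_{1,k})$, $\gamma_{2,k+1}=\max(\underline{\gamma_2},\varrho\gamma_{2,k})$. In the SVDs, $\widehat{P}^{k+1}\in\mathbb{O}^{n\times r}$, $P^{k+1}\in\mathbb{O}^{m\times r}$, $\widehat{Q}^{k+1},Q^{k+1}\in\mathbb{O}^r$, and $\widehat{D}^{k+1},D^{k+1}$ are $r\times r$ diagonal with nonnegative, nonincreasing diagonal entries (so their squares carry the singular values). The method is regarded as generating infinite sequences; $\overline{U}^k,\overline{V}^k$ are defined for $k\ge0$ and $U^k,V^k,\widehat{U}^k,\widehat{V}^k$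 for $k\ge1$. *)

(* Defs.v *)
From HB Require Import structures.
From mathcomp Require Import all_boot all_order all_algebra.
From mathcomp Require Import all_classical all_reals all_analysis.

Set Implicit Arguments.
Unset Strict Implicit.
Unset Printing Implicit Defensive.

Import Order.TTheory GRing.Theory Num.Theory.
Import numFieldNormedType.Exports.

Local Open Scope classical_set_scope.
Local Open Scope ring_scope.

Definition frob_ip (R : realType) (n m : nat) (A B : 'M[R]_(n, m)) : R :=
  \tr (A^T *m B).

(* The library norm `|A| on matrices is the maximum of the absolute values of
   the entries, hence the separate Frobenius norm. *)
Definition frob_norm (R : realType) (n m : nat) (A : 'M[R]_(n, m)) : R :=
  Num.sqrt (frob_ip A A).

Definition grad (R : realType) (n m : nat) (f : 'M[R]_(n, m) -> R)
    (X : 'M[R]_(n, m)) : 'M[R]_(n, m) :=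
  \matrix_(i, j) 'D_(delta_mx i j) f X.

(* J_Z *)
Definition col_support (R : realType) (n r : nat) (Z : 'M[R]_(n, r)) :
    {set 'I_r} :=
  [set j | col j Z != 0]%SET.

(* ||Z||_{2,0} *)
Definition norm20 (R : realType) (n r : nat) (Z : 'M[R]_(n, r)) : nat :=
  #|col_support Z|.

Definition orthonormal_cols (R : realType) (n k : nat) (A : 'M[R]_(n, k)) :
    Prop :=
  A^T *m A = 1%:M.

Definition sorted_diag (R : realType) (r : nat) (D : 'M[R]_r) : Prop :=
  [/\ is_diag_mx D,
      forall i, 0 <= D i i
    & forall i j : 'I_r, (i <= j)%N -> D j j <= D i i].

Definition argmin (R : realType) (T : Type) (F : T -> R) : set T :=
  [set x | forall y, F x <= F y].

Section Objective.
Context (R : realType) (n m r : nat).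
Context (f : 'M[R]_(n, m) -> R) (Lf lambda mu : R).

Definition regularizer (U : 'M[R]_(n, r)) (V : 'M[R]_(m, r)) : R :=
  mu / 2 * (frob_norm U ^+ 2 + frob_norm V ^+ 2)
  + lambda * ((norm20 U)%:R + (norm20 V)%:R).

Definition Phi (U : 'M[R]_(n, r)) (V : 'M[R]_(m, r)) : R :=
  f (U *m V^T) + regularizer U V.

Definition Phi_hat (U : 'M[R]_(n, r)) (V : 'M[R]_(m, r))
    (G : 'M[R]_(n, r)) (H : 'M[R]_(m, r)) : R :=
  f (G *m H^T)
  + frob_ip (grad f (G *m H^T)) (U *m V^T - G *m H^T)
  + Lf / 2 * frob_norm (U *m V^T - G *m H^T) ^+ 2
  + regularizer U V.

End Objective.

(* Data of a run. Only [Ubar], [Vbar], [P], [D], [gamma1] and [gamma2] are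
   meaningful at index 0; the other sequences start at index 1 and their value
   at 0 is unconstrained. The initial Q^0 is n x r whereas the later Q^k are
   r x r, so it is a separate field. *)
Record map_run (R : realType) (n m r : nat) := MapRun {
  U : nat -> 'M[R]_(n, r);
  V : nat -> 'M[R]_(m, r);
  Uhat : nat -> 'M[R]_(n, r);
  Vhat : nat -> 'M[R]_(m, r);
  Ubar : nat -> 'M[R]_(n, r);
  Vbar : nat -> 'M[R]_(m, r);
  Q0 : 'M[R]_(n, r);
  P : nat -> 'M[R]_(m, r);
  D : nat -> 'M[R]_r;
  Q : nat -> 'M[R]_r;
  Phat : nat -> 'M[R]_(n, r);
  Dhat : nat -> 'M[R]_r;
  Qhat : nat -> 'M[R]_r;
  gamma1 : nat -> R;
  gamma2 : nat -> R }.

Record generated_by_MAP (R : realType) (n m r : nat)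
    (f : 'M[R]_(n, m) -> R) (Lf lambda mu : R)
    (rho gamma1_low gamma2_low : R) (s : map_run R n m r) : Prop := {
  MAP_rho : 0 < rho < 1;
  MAP_gamma1_low : 0 < gamma1_low;
  MAP_gamma2_low : 0 < gamma2_low;
  MAP_gamma1_0 : 0 < gamma1 s 0%N;
  MAP_gamma2_0 : 0 < gamma2 s 0%N;
  MAP_P0 : orthonormal_cols (P s 0%N);
  MAP_Q0 : orthonormal_cols (Q0 s);
  MAP_D0 : D s 0%N = 1%:M;
  MAP_Ubar0 : Ubar s 0%N = Q0 s;
  MAP_Vbar0 : Vbar s 0%N = P s 0%N;
  MAP_U : forall k,
    argmin (fun W : 'M[R]_(n, r) =>
        Phi_hat f Lf lambda mu W (Vbar s k) (Ubar s k) (Vbar s k)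
        + gamma1 s k / 2 * frob_norm (W - Ubar s k) ^+ 2)
      (U s k.+1);
  MAP_Phat : forall k, orthonormal_cols (Phat s k.+1);
  MAP_Qhat : forall k, orthonormal_cols (Qhat s k.+1);
  MAP_Dhat : forall k, sorted_diag (Dhat s k.+1);
  MAP_svd_hat : forall k,
    U s k.+1 *m D s k
    = Phat s k.+1 *m (Dhat s k.+1 *m Dhat s k.+1) *m (Qhat s k.+1)^T;
  MAP_Uhat : forall k, Uhat s k.+1 = Phat s k.+1 *m Dhat s k.+1;
  MAP_Vhat : forall k,
    Vhat s k.+1 = P s k *m Qhat s k.+1 *m Dhat s k.+1;
  MAP_V : forall k,
    argmin (fun W : 'M[R]_(m, r) =>
        Phi_hat f Lf lambda mu (Uhat s k.+1) W (Uhat s k.+1) (Vhat s k.+1)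
        + gamma2 s k / 2 * frob_norm (W - Vhat s k.+1) ^+ 2)
      (V s k.+1);
  MAP_P : forall k, orthonormal_cols (P s k.+1);
  MAP_Q : forall k, orthonormal_cols (Q s k.+1);
  MAP_D : forall k, sorted_diag (D s k.+1);
  MAP_svd_bar : forall k,
    V s k.+1 *m Dhat s k.+1
    = P s k.+1 *m (D s k.+1 *m D s k.+1) *m (Q s k.+1)^T;
  MAP_Ubar : forall k,
    Ubar s k.+1 = Phat s k.+1 *m Q s k.+1 *m D s k.+1;
  MAP_Vbar : forall k, Vbar s k.+1 = P s k.+1 *m D s k.+1;
  MAP_gamma1 : forall k,
    gamma1 s k.+1 = Num.max gamma1_low (rho * gamma1 s k);
  MAP_gamma2 : forall k,
    gamma2 s k.+1 = Num.max gamma2_low (rho * gamma2 s k) }.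

(* Main.v *)
(* The proximal U-step decreases [Phi] by the descent lemma for [f]. The SVD of
   [U *m D] then keeps the product [U *m V^T] while balancing the factors, which
   lowers the regularizer: the common squared norm of the new factors is the
   nuclear norm of [U *m D], at most [(|U|^2 + |D|^2) / 2], and their number of
   nonzero columns is the rank of [U *m D]. The V-step is the same up to
   transposition. Boundedness follows from the coercivity of the [mu]-term.

   A column of [U^{k+1}] is zero as soon as the same column of [Vbar^k] is, since
   it only adds to the proximal and regularization terms. Hence the sizes of the supports of [D^k],
   [U^{k+1}], [Dhat^{k+1}], [V^{k+1}], [D^{k+1}], ... decrease and stabilize;
   being nested, or initial segments for the sorted diagonal matrices, supports
   of equal size are equal. *)
Require Import Defs.
From HB Require Import structures.
From mathcomp Require Import all_boot all_order all_algebra.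
From mathcomp Require Import all_classical all_reals all_analysis.
From mathcomp Require Import ring lra.
Import Order.TTheory GRing.Theory Num.Theory.
Import numFieldNormedType.Exports.
Local Open Scope classical_set_scope.
Local Open Scope ring_scope.

Set Implicit Arguments.
Unset Strict Implicit.
Unset Printing Implicit Defensive.

(** * The Frobenius inner product and norm *)

Section Frobenius.
Context (R : realType) (n m : nat).
Implicit Types A B C : 'M[R]_(n, m).

Lemma frob_ipE A B : frob_ip A B = \sum_j \sum_i A i j * B i j.
Proof.
by apply: eq_bigr => j _; rewrite mxE; apply: eq_bigr => i _; rewrite mxE.
Qed.

Lemma frob_ipC A B : frob_ip A B = frob_ip B A.
Proof. by rewrite /frob_ip -mxtrace_tr trmx_mul trmxK. Qed.

Lemma frob_ipDr A B C : frob_ip A (B + C) = frob_ip A B + frob_ip A C.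
Proof. by rewrite /frob_ip mulmxDr raddfD. Qed.

Lemma frob_ipNr A B : frob_ip A (- B) = - frob_ip A B.
Proof. by rewrite /frob_ip mulmxN raddfN. Qed.

Lemma frob_ipZr a A B : frob_ip A (a *: B) = a * frob_ip A B.
Proof. by rewrite /frob_ip -scalemxAr mxtraceZ. Qed.

Lemma frob_ipBr A B C : frob_ip A (B - C) = frob_ip A B - frob_ip A C.
Proof. by rewrite frob_ipDr frob_ipNr. Qed.

Lemma frob_ipBl A B C : frob_ip (A - B) C = frob_ip A C - frob_ip B C.
Proof. by rewrite frob_ipC frob_ipBr !(frob_ipC C). Qed.

Lemma frob_ipZl a A B : frob_ip (a *: A) B = a * frob_ip A B.
Proof. by rewrite frob_ipC frob_ipZr frob_ipC. Qed.

Lemma frob_ip_ge0 A : 0 <= frob_ip A A.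
Proof.
rewrite frob_ipE; apply: sumr_ge0 => j _; apply: sumr_ge0 => i _.
by rewrite -expr2 sqr_ge0.
Qed.

Lemma frob_norm_ge0 A : 0 <= frob_norm A.
Proof. exact: sqrtr_ge0. Qed.

Lemma frob_norm_sqr A : frob_norm A ^+ 2 = frob_ip A A.
Proof. by rewrite sqr_sqrtr// frob_ip_ge0. Qed.

Lemma frob_normZ a A : frob_norm (a *: A) = `|a| * frob_norm A.
Proof.
by rewrite /frob_norm frob_ipZl frob_ipZr mulrA -expr2 sqrtrM
  ?sqr_ge0// sqrtr_sqr.
Qed.

Lemma frob_ip0r A : frob_ip A 0 = 0.
Proof. by rewrite /frob_ip mulmx0 mxtrace0. Qed.

Lemma frob_norm0 : frob_norm (0 : 'M[R]_(n, m)) = 0.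
Proof. by rewrite /frob_norm frob_ip0r sqrtr0. Qed.

Lemma frob_ip_le_half A B :
  frob_ip A B <= (frob_norm A ^+ 2 + frob_norm B ^+ 2) / 2.
Proof.
have := frob_ip_ge0 (A - B).
rewrite frob_ipBl !frob_ipBr (frob_ipC B A) -!frob_norm_sqr; lra.
Qed.

Lemma frob_norm_eq0 A : frob_norm A = 0 -> A = 0.
Proof.
move=> A0; have := frob_norm_sqr A; rewrite A0 expr0n/= frob_ipE => /esym/eqP.
have ge0 j i : true -> 0 <= A i j * A i j by rewrite -expr2 sqr_ge0.
rewrite psumr_eq0 => [/allP Aj0|j _]; last by apply: sumr_ge0 => i; exact: ge0.
apply/matrixP => i j; move: (Aj0 j (mem_index_enum _)) => /=.
rewrite psumr_eq0 => [/allP/(_ i (mem_index_enum _))/=|k]; last exact: ge0.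
by rewrite mulf_eq0 orbb mxE => /eqP.
Qed.

(** The matrices [b *: A] and [a *: B] have the same norm [a * b], so the bound by the half sum of
    squares is tight enough for them; dividing by [a * b] gives the claim. Zero norms are treated
    apart. *)
Lemma frob_cauchy_schwarz A B : frob_ip A B <= frob_norm A * frob_norm B.
Proof.
have [A0|A0] := eqVneq (frob_norm A) 0.
  by rewrite A0 (frob_norm_eq0 A0) frob_ipC frob_ip0r mul0r.
have [B0|B0] := eqVneq (frob_norm B) 0.
  by rewrite B0 (frob_norm_eq0 B0) frob_ip0r mulr0.
set a := frob_norm A; set b := frob_norm B.
have ab0 : 0 < a * b by rewrite mulr_gt0 ?lt0r ?A0 ?B0 ?frob_norm_ge0.
have := frob_ip_le_half (b *: A) (a *: B).
rewrite frob_ipZl frob_ipZr mulrA (mulrC b) !frob_normZ.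
rewrite !ger0_norm ?frob_norm_ge0// -/a -/b => H.
by rewrite -(ler_pM2l ab0) (le_trans H)//; lra.
Qed.

(** The square of each entry is one term of the sum of squares. This passes from Frobenius estimates
    to the max norm in which boundedness is expressed. *)
Lemma ler_mx_norm_frob A : `|A| <= frob_norm A.
Proof.
rewrite [leLHS]mx_normrE; apply: bigmax_le => [|[i j] _ /=].
  exact: frob_norm_ge0.
rewrite -(@ler_sqr _ _ (frob_norm A)) ?nnegrE ?frob_norm_ge0//.
rewrite real_normK ?num_real// frob_norm_sqr frob_ipE (bigD1 j)//= (bigD1 i)//=.
rewrite -expr2 -addrA lerDl addr_ge0//; last apply: sumr_ge0 => k _.
  by apply: sumr_ge0 => k _; rewrite -expr2 sqr_ge0.
by apply: sumr_ge0 => l _; rewrite -expr2 sqr_ge0.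
Qed.

End Frobenius.

(** * Multiplication by matrices with orthonormal columns *)

Section Orthonormal.
Context (R : realType).

Lemma frob_norm_mulmx_orthonormal (n k l : nat) (A : 'M[R]_(n, k))
    (Z : 'M[R]_(k, l)) :
  orthonormal_cols A -> frob_norm (A *m Z) = frob_norm Z.
Proof.
rewrite /orthonormal_cols => A1; rewrite /frob_norm /frob_ip trmx_mul.
by rewrite -mulmxA (mulmxA A^T) A1 mul1mx.
Qed.

Lemma orthonormal_cols_mulmx (n k l : nat) (A : 'M[R]_(n, k))
    (B : 'M[R]_(k, l)) :
  orthonormal_cols A -> orthonormal_cols B -> orthonormal_cols (A *m B).
Proof.
rewrite /orthonormal_cols => A1 B1.
by rewrite trmx_mul -mulmxA (mulmxA A^T) A1 mul1mx.
Qed.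

(** For a square matrix a left inverse is also a right inverse. *)
Lemma orthonormal_cols_trmx (r : nat) (A : 'M[R]_r) :
  orthonormal_cols A -> orthonormal_cols A^T.
Proof. by rewrite /orthonormal_cols trmxK => /mulmx1C. Qed.

(** Left multiplication by [A] is injective, with left inverse [A^T], so it kills no nonzero
    column. *)
Lemma col_support_mulmx_orthonormal (n k l : nat) (A : 'M[R]_(n, k))
    (Z : 'M[R]_(k, l)) :
  orthonormal_cols A -> col_support (A *m Z) = col_support Z.
Proof.
move=> A1; apply/setP => j; rewrite !inE !colE -mulmxA.
congr negb; apply/eqP/eqP => [|->]; last by rewrite mulmx0.
by move=> /(congr1 (mulmx A^T)); rewrite mulmxA A1 mul1mx mulmx0.
Qed.

End Orthonormal.

(** * Column supports, rank and sorted diagonal matrices *)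

Section Support.
Context (R : realType).

(** The nonzero columns span the column space. The argument runs on the rows of [Z^T], since
    subspaces are represented as row spaces. *)
Lemma norm20_ge_rank (n r : nat) (Z : 'M[R]_(n, r)) : (\rank Z <= norm20 Z)%N.
Proof.
have sub : (Z^T <= \sum_(j in col_support Z) <<row j Z^T>>)%MS.
  apply/row_subP => j; have [jZ|] := boolP (j \in col_support Z).
    by rewrite (sumsmx_sup j)// genmxE.
  by rewrite inE negbK -tr_col => /eqP ->; rewrite trmx0 sub0mx.
rewrite -mxrank_tr (leq_trans (mxrankS sub))//.
rewrite (leq_trans (mxrank_sum_leqif _).1)//= /norm20 -sum1_card.
rewrite leq_sum// => j _.
by rewrite mxrank_gen rank_leq_row.
Qed.

Lemma mem_col_support_diag (r : nat) (D : 'M[R]_r) (i : 'I_r) :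
  is_diag_mx D -> (i \in col_support D) = (D i i != 0).
Proof.
move=> /is_diag_mxP D0; rewrite inE; congr negb.
apply/eqP/eqP => [/colP/(_ i)|Dii]; first by rewrite !mxE.
by apply/colP => k; rewrite !mxE; have [->//|/D0] := eqVneq k i.
Qed.

(** Row [i] of [D *m D] is a multiple of the [i]-th unit vector, nonzero for [i] in the support, and
    unit vectors are independent. *)
Lemma norm20_le_rank_sqr (r : nat) (D : 'M[R]_r) :
  is_diag_mx D -> (norm20 D <= \rank (D *m D))%N.
Proof.
move=> Ddiag.
have D0 i j : i != j -> D i j = 0 by apply/is_diag_mxP.
have DDE i : row i (D *m D) = D i i ^+ 2 *: delta_mx 0 i.
  apply/rowP => j; rewrite !mxE eqxx /= (bigD1 i)//= big1 => [|k ki]; last first.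
    by rewrite D0 ?mul0r// eq_sym.
  by rewrite addr0; case: eqVneq => [->|ji]; rewrite ?mulr1//
    (D0 i j) ?mulr0// eq_sym.
have sub : (\sum_(i in col_support D) <<delta_mx 0 i : 'rV[R]_r>> <= D *m D)%MS.
  apply/sumsmx_subP => i; rewrite mem_col_support_diag// => Dii; rewrite genmxE.
  rewrite -(eqmx_scale _ (a := D i i ^+ 2)) ?expf_neq0// -DDE; exact: row_sub.
apply: leq_trans (mxrankS sub).
have /mxdirectP/= -> := @mxdirect_delta R _ (mem (col_support D)) r id
  (fun _ _ _ _ => id).
rewrite /norm20 -sum1_card leq_sum// => i _.
by rewrite mxrank_gen mxrank_delta.
Qed.

(* The support of a sorted diagonal matrix is an initial segment of ['I_r], so
   it is determined by its size. *)
Lemma col_support_sorted_diag (r : nat) (D E : 'M[R]_r) :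
  sorted_diag D -> sorted_diag E -> norm20 D = norm20 E ->
  col_support D = col_support E.
Proof.
have init (F : 'M[R]_r) (i j : 'I_r) : sorted_diag F -> (i <= j)%N ->
    j \in col_support F -> i \in col_support F.
  move=> [Fdiag Fge0 Fle] ij; rewrite !mem_col_support_diag// => Fj.
  by rewrite gt_eqF// (lt_le_trans _ (Fle _ _ ij))// lt0r Fj Fge0.
(* Two initial segments are always comparable for inclusion. *)
have sub (F G : 'M[R]_r) : sorted_diag F -> sorted_diag G ->
    ~~ (col_support F \subset col_support G) ->
    col_support G \subset col_support F.
  move=> hF hG /subsetPn[i iF iG]; apply/fintype.subsetP => j jG.
  have [ij|/ltnW ji] := leqP i j; last exact: init ji iF.
  by rewrite (init _ _ _ hG ij jG) in iG.
move=> hD hE DE; have [DsE|/(sub _ _ hD hE) EsD] :=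
  boolP (col_support D \subset col_support E).
  by apply/eqP; rewrite eqEcard DsE/= -/(norm20 _) -/(norm20 _) DE.
by apply/esym/eqP; rewrite eqEcard EsD/= -/(norm20 _) -/(norm20 _) DE.
Qed.

End Support.

(** * The descent lemma for a Lipschitz gradient *)

Section Descent.
Context (R : realType) (n m : nat) (f : 'M[R]_(n, m) -> R).

(** [grad] only records derivatives along the elementary matrices; differentiability makes the
    derivative linear in [H], which is then expanded in that basis. *)
Lemma derive_grad X H : differentiable f X -> 'D_H f X = frob_ip (grad f X) H.
Proof.
move=> df; rewrite frob_ipE deriveE// {1}(matrix_sum_delta H) exchange_big/=.
rewrite linear_sum; apply: eq_bigr => j _.
rewrite linear_sum; apply: eq_bigr => i _.
by rewrite linearZ/= mxE deriveE// mulrC.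
Qed.

Lemma is_derive_line X H (t : R) : differentiable f (X + t *: H) ->
  is_derive t 1 (fun t => f (X + t *: H)) (frob_ip (grad f (X + t *: H)) H).
Proof.
move=> df; rewrite -derive_grad//.
(* The difference quotient of the restriction to the line at [t] is that of [f] at [X + t *: H] in
   direction [H]. *)
have E : (fun h : R => h^-1 *: (((fun t => f (X + t *: H)) \o shift t) (h *: 1)
            - f (X + t *: H))) =
    (fun h => h^-1 *: ((f \o shift (X + t *: H)) (h *: H) - f (X + t *: H))).
  apply/funext => h /=; congr (_ *: (f _ - _)).
  by rewrite [h *: 1]mulr1 scalerDl addrCA.
split; last by rewrite /derive E.
by rewrite /derivable E; exact: diff_derivable.
Qed.

(** The mean value theorem on [[0, 1]], applied to [f] along the segment minus the quadratic
    [a * t + b * t ^+ 2], replaces the usual integral: the increment of [h] is [dh c], and the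
    Lipschitz bound at [X + c *: H] makes [dh c] nonpositive. *)
Lemma descent_lemma (Lf : R) :
  (forall X, differentiable f X) ->
  (forall X Y, frob_norm (grad f X - grad f Y) <= Lf * frob_norm (X - Y)) ->
  forall X Y, f Y <= f X + frob_ip (grad f X) (Y - X)
                     + Lf / 2 * frob_norm (Y - X) ^+ 2.
Proof.
move=> df lip X Y; set H := Y - X.
set a := frob_ip (grad f X) H; set b := Lf / 2 * frob_norm H ^+ 2.
pose h (t : R) := f (X + t *: H) - (a * t + b * t ^+ 2).
pose dh (t : R) := frob_ip (grad f (X + t *: H)) H - (a + b * (2 * t)).
have hder (t : R) : is_derive t 1 h (dh t).
  rewrite /h /dh; have := @is_derive_line X H t (df _) => ?.
  apply: is_deriveB.
  apply: is_derive_eq; rewrite /GRing.scale/=; ring.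
have hcont : {within `[0, 1], continuous h}.
  by apply: derivable_within_continuous => t _; exact: ex_derive.
have [c] := MVT ltr01 (fun t _ => hder t) hcont.
rewrite in_itv/= => /andP[c0 _].
rewrite subr0 mulr1 /h /dh scale1r scale0r addr0 subrKC => E.
have : frob_ip (grad f (X + c *: H)) H - a <= Lf * c * frob_norm H ^+ 2.
  rewrite -frob_ipBl (le_trans (frob_cauchy_schwarz _ _))//.
  rewrite expr2 mulrA ler_wpM2r ?frob_norm_ge0// (le_trans (lip _ _))//.
  by rewrite addrAC subrr add0r frob_normZ gtr0_norm// mulrA.
move: E; rewrite /b; nra.
Qed.

End Descent.

(** * Rebalancing the factors by an SVD *)

Section Balance.
Context (R : realType) (n m r : nat) (lambda mu : R).

Lemma regularizerC (U : 'M[R]_(n, r)) (V : 'M[R]_(m, r)) :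
  regularizer lambda mu U V = regularizer lambda mu V U.
Proof.
by rewrite /regularizer (addrC (frob_norm U ^+ 2)) (addrC (norm20 U)%:R).
Qed.

Lemma tr_diag_mx (D : 'M[R]_r) : is_diag_mx D -> D^T = D.
Proof.
move=> /is_diag_mxP D0; apply/matrixP => i j; rewrite mxE.
by have [->//|ij] := eqVneq i j; rewrite !D0// eq_sym.
Qed.

Variables (U : 'M[R]_(n, r)) (P : 'M[R]_(m, r)) (D : 'M[R]_r).
Variables (P' : 'M[R]_(n, r)) (D' Q' : 'M[R]_r).
Hypothesis svd : U *m D = P' *m (D' *m D') *m Q'^T.
Hypotheses (Ddiag : is_diag_mx D) (D'diag : is_diag_mx D').

(** Both products equal [P' *m (D' *m D') *m Q'^T *m P^T]. The pair [(P' *m D', P *m Q' *m D')]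
    replaces [(U, P *m D)]; the V-step uses the same section with the roles of the two factors
    exchanged. *)
Lemma balance_mulmx :
  (P' *m D') *m (P *m Q' *m D')^T = U *m (P *m D)^T.
Proof.
rewrite !trmx_mul (tr_diag_mx Ddiag) (tr_diag_mx D'diag) [RHS]mulmxA svd.
by rewrite !mulmxA.
Qed.

Hypotheses (orthP : orthonormal_cols P) (orthP' : orthonormal_cols P').
Hypothesis orthQ' : orthonormal_cols Q'.

Lemma balance_sqrD : D' *m D' = P'^T *m (U *m D) *m Q'.
Proof. by rewrite svd !mulmxA orthP' mul1mx -mulmxA orthQ' mulmx1. Qed.

(* The left-hand side is the nuclear norm of [U *m D]. *)
Lemma balance_frob_norm :
  frob_norm D' ^+ 2 <= (frob_norm U ^+ 2 + frob_norm D ^+ 2) / 2.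
Proof.
(* Cyclicity of the trace turns the trace of [D' *m D'] into an inner product of [U] with an
   isometric image of [D]. *)
have -> : frob_norm D' ^+ 2 = frob_ip U (P' *m (Q'^T *m D)).
  rewrite frob_norm_sqr /frob_ip (tr_diag_mx D'diag) balance_sqrD -mxtrace_tr.
  rewrite !trmx_mul trmxK (tr_diag_mx Ddiag) mxtrace_mulC -!mulmxA.
  by rewrite mxtrace_mulC !mulmxA.
have orthQT := orthonormal_cols_trmx orthQ'.
rewrite -(frob_norm_mulmx_orthonormal D orthQT).
by rewrite -(frob_norm_mulmx_orthonormal (Q'^T *m D) orthP') frob_ip_le_half.
Qed.

(** The support of [D'] has at most as many elements as the rank of [D' *m D'], which is at most the
    rank of [U], hence at most its number of nonzero columns. *)
Lemma balance_norm20 : (norm20 D' <= norm20 U)%N.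
Proof.
rewrite (leq_trans _ (norm20_ge_rank U))//.
rewrite (leq_trans (norm20_le_rank_sqr D'diag))// balance_sqrD.
by rewrite (leq_trans (mxrankM_maxl _ _))// mulmxA
  (leq_trans (mxrankM_maxl _ _))// mxrankM_maxr.
Qed.

(** Both new factors have the norm and the support of [D']. The norms are compared by
    [balance_frob_norm]; of the two copies of [norm20 D'], one is bounded by [norm20 U] and the
    other, through it, by [norm20 D]. *)
Lemma balance_regularizer : 0 < lambda -> 0 < mu ->
  (norm20 U <= norm20 D)%N ->
  regularizer lambda mu (P' *m D') (P *m Q' *m D') <=
  regularizer lambda mu U (P *m D).
Proof.
move=> l0 m0 UD; rewrite /regularizer /norm20.
have orthPQ := orthonormal_cols_mulmx orthP orthQ'.
rewrite !frob_norm_mulmx_orthonormal// !col_support_mulmx_orthonormal//.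
rewrite lerD// ler_pM2l//.
- by have := balance_frob_norm; lra.
- by rewrite divr_gt0.
- have h := balance_norm20.
  by rewrite lerD// ler_nat// (leq_trans h).
Qed.

End Balance.

(** * Supports of minimizers, bounded sublevel sets and stationary integer sequences *)

(* Deleting a column where [B] vanishes leaves [Z *m B^T] unchanged and saves
   [lambda]. *)
Lemma argmin_col_support (R : realType) (n p r : nat) (lambda mu gamma : R)
    (g : 'M[R]_(n, p) -> R) (B : 'M[R]_(p, r)) (G Z : 'M[R]_(n, r)) :
  0 < lambda -> 0 <= mu -> 0 <= gamma ->
  col_support G \subset col_support B ->
  argmin (fun W => g (W *m B^T) + mu * frob_norm W ^+ 2
                   + lambda * (norm20 W)%:R
                   + gamma * frob_norm (W - G) ^+ 2) Z ->
  col_support Z \subset col_support B.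
Proof.
move=> l0 m0 g0 GB Zmin; apply/fintype.subsetP => j jZ.
apply: contraT => jB.
have jG : j \notin col_support G
  by apply: contra jB; exact: (fintype.subsetP GB).
have col0 (q : nat) (A : 'M[R]_(q, r)) i : j \notin col_support A -> A i j = 0.
  by rewrite inE negbK => /eqP/colP/(_ i); rewrite !mxE.
(* The competitor is [Z] with its column [j] erased. *)
pose W : 'M[R]_(n, r) := \matrix_(i, l) if l == j then 0 else Z i l.
have WB : W *m B^T = Z *m B^T.
  apply/matrixP => i k; rewrite !mxE; apply: eq_bigr => l _; rewrite !mxE.
  by case: eqVneq => // ->; rewrite col0// !mulr0.
have mono (A A' : 'M[R]_(n, r)) : (forall i l, A i l = 0 \/ A i l = A' i l) ->
    frob_norm A ^+ 2 <= frob_norm A' ^+ 2.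
  move=> AA'; rewrite !frob_norm_sqr !frob_ipE.
  apply: ler_sum => l _; apply: ler_sum => i _.
  by have [->|->//] := AA' i l; rewrite mul0r -expr2 sqr_ge0.
have WZ : frob_norm W ^+ 2 <= frob_norm Z ^+ 2.
  by apply: mono => i l; rewrite mxE; case: eqP; [left|right].
(* Column [j] of [G] vanishes along with that of [B], so erasing it in [Z] does not increase the
   distance to [G]. *)
have WGZG : frob_norm (W - G) ^+ 2 <= frob_norm (Z - G) ^+ 2.
  apply: mono => i l; rewrite !mxE; case: eqVneq => [->|_]; last by right.
  by left; rewrite col0// subrr.
have W20 : (norm20 W < norm20 Z)%N.
  apply/proper_card/properP; split.
    apply/fintype.subsetP => l; rewrite !inE; apply: contra => /eqP/colP Zl.
    apply/eqP/colP => i; have := Zl i; rewrite !mxE => ->; by case: ifP.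
  exists j => //; rewrite inE negbK; apply/eqP/colP => i.
  by rewrite !mxE eqxx.
have := Zmin W; rewrite /= WB leNgt => /negP[].
rewrite ltr_leD// ?ler_wpM2l// ler_ltD// ?ltr_pM2l ?ltr_nat//.
by rewrite lerD// ler_wpM2l.
Qed.

(** Since [f] and the [lambda]-term are nonnegative, the [mu]-term alone is at most [c]. *)
Lemma Phi_bound (R : realType) (n m r : nat) (f : 'M[R]_(n, m) -> R)
    (lambda mu c : R) (A : 'M[R]_(n, r)) (B : 'M[R]_(m, r)) :
  (forall X, 0 <= f X) -> 0 < lambda -> 0 < mu -> Phi f lambda mu A B <= c ->
  `|A| <= Num.sqrt (2 / mu * c) /\ `|B| <= Num.sqrt (2 / mu * c).
Proof.
move=> f0 l0 m0; rewrite /Phi /regularizer => Hc.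
have : frob_norm A ^+ 2 + frob_norm B ^+ 2 <= 2 / mu * c.
  rewrite -ler_pdivrMl ?divr_gt0// invf_div (le_trans _ Hc)//.
  by rewrite addrCA lerDl addr_ge0// mulr_ge0// ltW.
have A0 := sqr_ge0 (frob_norm A); have B0 := sqr_ge0 (frob_norm B).
move=> H; have c0 : 0 <= 2 / mu * c by rewrite (le_trans _ H)// addr_ge0.
have le (q : nat) (Z : 'M[R]_(q, r)) : frob_norm Z ^+ 2 <= 2 / mu * c ->
    `|Z| <= Num.sqrt (2 / mu * c).
  move=> Zc; apply: le_trans (ler_mx_norm_frob _) _.
  by apply: ler_wsqrtr; rewrite -frob_norm_sqr.
by split; apply: le; rewrite (le_trans _ H)// ?lerDl ?lerDr.
Qed.

(** [K] is an index where the least value is attained; no later term can be smaller. *)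
Lemma nonincreasing_nat_stationary (u : nat -> nat) :
  (forall k, (u k.+1 <= u k)%N) ->
  exists K, forall k, (K <= k)%N -> u k = u K.
Proof.
move=> ud; pose p i := `[< exists k, u k = i >].
have [|_ /asboolP[K <-] Kmin] := @ex_minnP p.
  by exists (u 0%N); apply/asboolP; exists 0%N.
exists K => k Kk; apply/eqP; rewrite eqn_leq Kmin; last first.
  by apply/asboolP; exists k.
rewrite andbT -(subnKC Kk); elim: (k - K)%N => [|i IHi]; first by rewrite addn0.
by rewrite addnS (leq_trans (ud _)).
Qed.

(** * Parameters and supports along a run *)

Section Run.
Context (R : realType) (n m r : nat) (f : 'M[R]_(n, m) -> R).
Context (Lf lambda mu rho gamma1_low gamma2_low : R) (s : map_run R n m r).
Hypothesis hf_ge0 : forall X, 0 <= f X.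
Hypothesis hf_diff : forall X, differentiable f X.
Hypothesis hf_lip : forall X Y,
  frob_norm (grad f X - grad f Y) <= Lf * frob_norm (X - Y).
Hypotheses (hlambda : 0 < lambda) (hmu : 0 < mu).
Hypothesis hs : generated_by_MAP f Lf lambda mu rho gamma1_low gamma2_low s.

Lemma gamma1_gt0 k : 0 < gamma1 s k.
Proof.
case: k => [|k]; first exact: MAP_gamma1_0 hs.
by rewrite (MAP_gamma1 hs) lt_max (MAP_gamma1_low hs).
Qed.

Lemma gamma2_gt0 k : 0 < gamma2 s k.
Proof.
case: k => [|k]; first exact: MAP_gamma2_0 hs.
by rewrite (MAP_gamma2 hs) lt_max (MAP_gamma2_low hs).
Qed.

Lemma D_sorted k : sorted_diag (D s k).
Proof.
case: k => [|k]; last exact: MAP_D hs k.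
rewrite (MAP_D0 hs); split=> [|i|i j _]; rewrite ?scalar_mx_is_diag//.
  by rewrite mxE eqxx ler01.
by rewrite !mxE !eqxx.
Qed.

Lemma D_diag k : is_diag_mx (D s k). Proof. by case: (D_sorted k). Qed.

Lemma Dhat_diag k : is_diag_mx (Dhat s k.+1).
Proof. by case: (MAP_Dhat hs k). Qed.

Lemma P_orthonormal k : orthonormal_cols (P s k).
Proof. by case: k => [|k]; [exact: MAP_P0 hs|exact: MAP_P hs k]. Qed.

(** The initialization [D^0 = I] makes the update formula valid at index 0 too, so the first
    iteration needs no separate treatment. *)
Lemma VbarE k : Vbar s k = P s k *m D s k.
Proof.
case: k => [|k]; [by rewrite (MAP_Vbar0 hs) (MAP_D0 hs) mulmx1|].
exact: MAP_Vbar hs k.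
Qed.

Lemma col_support_Vbar k : col_support (Vbar s k) = col_support (D s k).
Proof.
by rewrite VbarE col_support_mulmx_orthonormal//; exact: P_orthonormal.
Qed.

Lemma col_support_Ubar k : col_support (Ubar s k) = col_support (D s k).
Proof.
case: k => [|k].
  rewrite (MAP_Ubar0 hs) (MAP_D0 hs) -{1}(mulmx1 (Q0 s)).
  by rewrite col_support_mulmx_orthonormal//; exact: MAP_Q0 hs.
rewrite (MAP_Ubar hs) col_support_mulmx_orthonormal//.
exact: orthonormal_cols_mulmx (MAP_Phat hs k) (MAP_Q hs k).
Qed.

Lemma col_support_Uhat k :
  col_support (Uhat s k.+1) = col_support (Dhat s k.+1).
Proof.
by rewrite (MAP_Uhat hs) col_support_mulmx_orthonormal//; exact: MAP_Phat hs k.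
Qed.

Lemma col_support_Vhat k :
  col_support (Vhat s k.+1) = col_support (Dhat s k.+1).
Proof.
rewrite (MAP_Vhat hs) col_support_mulmx_orthonormal//.
exact: orthonormal_cols_mulmx (P_orthonormal k) (MAP_Qhat hs k).
Qed.

(** * Decrease of the objective in the two proximal steps *)

Lemma Phi_hat_diag (G : 'M[R]_(n, r)) (H : 'M[R]_(m, r)) :
  Phi_hat f Lf lambda mu G H G H = Phi f lambda mu G H.
Proof.
by rewrite /Phi_hat subrr frob_ip0r frob_norm0 expr0n/= mulr0 !addr0.
Qed.

(** This is the descent lemma at [G *m H^T]: the surrogate majorizes [Phi], and by [Phi_hat_diag] it
    touches it at the base point. *)
Lemma Phi_le_Phi_hat (A G : 'M[R]_(n, r)) (B H : 'M[R]_(m, r)) :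
  Phi f lambda mu A B <= Phi_hat f Lf lambda mu A B G H.
Proof. by rewrite /Phi /Phi_hat lerD2r descent_lemma. Qed.

(** The minimizer is compared with [Ubar s k], where the proximal term vanishes and the surrogate
    equals [Phi]. *)
Lemma U_decrease k :
  Phi f lambda mu (U s k.+1) (Vbar s k)
    + gamma1 s k / 2 * frob_norm (U s k.+1 - Ubar s k) ^+ 2
  <= Phi f lambda mu (Ubar s k) (Vbar s k).
Proof.
rewrite -[leRHS]Phi_hat_diag -[leRHS]addr0.
have := MAP_U hs k (Ubar s k); rewrite subrr frob_norm0.
rewrite expr0n/= mulr0; apply: le_trans.
by rewrite lerD2r Phi_le_Phi_hat.
Qed.

Lemma V_decrease k :
  Phi f lambda mu (Uhat s k.+1) (V s k.+1)
    + gamma2 s k / 2 * frob_norm (V s k.+1 - Vhat s k.+1) ^+ 2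
  <= Phi f lambda mu (Uhat s k.+1) (Vhat s k.+1).
Proof.
rewrite -[leRHS]Phi_hat_diag -[leRHS]addr0.
have := MAP_V hs k (Vhat s k.+1); rewrite subrr frob_norm0.
rewrite expr0n/= mulr0; apply: le_trans.
by rewrite lerD2r Phi_le_Phi_hat.
Qed.

(** * Supports and column counts of successive iterates *)

Lemma col_support_U k : col_support (U s k.+1) \subset col_support (D s k).
Proof.
rewrite -col_support_Vbar.
pose Y := Ubar s k *m (Vbar s k)^T.
(* [g] gathers the terms that depend on the variable only through its product with [(Vbar s k)^T],
   or not at all. *)
pose g X := f Y + frob_ip (grad f Y) (X - Y) + Lf / 2 * frob_norm (X - Y) ^+ 2
  + mu / 2 * frob_norm (Vbar s k) ^+ 2 + lambda * (norm20 (Vbar s k))%:R.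
apply: (@argmin_col_support _ _ _ _ lambda (mu / 2) (gamma1 s k / 2) g _
  (Ubar s k)).
- by [].
- by rewrite divr_ge0// ltW.
- by rewrite divr_ge0// ltW// gamma1_gt0.
- by rewrite col_support_Vbar col_support_Ubar.
- move=> W; have := MAP_U hs k W.
  by rewrite /= /Phi_hat /regularizer /g -/Y; lra.
Qed.

Lemma col_support_V k :
  col_support (V s k.+1) \subset col_support (Dhat s k.+1).
Proof.
rewrite -col_support_Uhat.
pose Y := Uhat s k.+1 *m (Vhat s k.+1)^T.
(* The variable is now the second factor, so the product that [argmin_col_support] provides is the
   transpose of the one inside [f]. *)
pose g X := f Y + frob_ip (grad f Y) (X^T - Y)
  + Lf / 2 * frob_norm (X^T - Y) ^+ 2
  + mu / 2 * frob_norm (Uhat s k.+1) ^+ 2 + lambda * (norm20 (Uhat s k.+1))%:R.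
apply: (@argmin_col_support _ _ _ _ lambda (mu / 2) (gamma2 s k / 2) g _
  (Vhat s k.+1)).
- by [].
- by rewrite divr_ge0// ltW.
- by rewrite divr_ge0// ltW// gamma2_gt0.
- by rewrite col_support_Uhat col_support_Vhat.
- move=> W; have := MAP_V hs k W.
  by rewrite /= /Phi_hat /regularizer /g !trmx_mul !trmxK -/Y; lra.
Qed.

Lemma norm20_U k : (norm20 (U s k.+1) <= norm20 (D s k))%N.
Proof. exact: subset_leq_card (col_support_U k). Qed.

Lemma norm20_V k : (norm20 (V s k.+1) <= norm20 (Dhat s k.+1))%N.
Proof. exact: subset_leq_card (col_support_V k). Qed.

Lemma norm20_Dhat k : (norm20 (Dhat s k.+1) <= norm20 (U s k.+1))%N.
Proof.
exact: balance_norm20 (MAP_svd_hat hs k) (Dhat_diag k) (MAP_Phat hs k)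
  (MAP_Qhat hs k).
Qed.

Lemma norm20_D k : (norm20 (D s k.+1) <= norm20 (V s k.+1))%N.
Proof.
exact: balance_norm20 (MAP_svd_bar hs k) (D_diag k.+1) (MAP_P hs k)
  (MAP_Q hs k).
Qed.

(** * Decrease of the objective in the two SVD steps *)

Lemma Phi_Uhat_Vhat_le k :
  Phi f lambda mu (Uhat s k.+1) (Vhat s k.+1)
  <= Phi f lambda mu (U s k.+1) (Vbar s k).
Proof.
rewrite /Phi (MAP_Uhat hs) (MAP_Vhat hs) VbarE.
rewrite (balance_mulmx _ (MAP_svd_hat hs k) (D_diag k) (Dhat_diag k)) lerD2l.
exact (balance_regularizer (MAP_svd_hat hs k) (D_diag k) (Dhat_diag k)
  (P_orthonormal k) (MAP_Phat hs k) (MAP_Qhat hs k) hlambda hmu (norm20_U k)).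
Qed.

Lemma Phi_Ubar_Vbar_le k :
  Phi f lambda mu (Ubar s k.+1) (Vbar s k.+1)
  <= Phi f lambda mu (Uhat s k.+1) (V s k.+1).
Proof.
rewrite /Phi (MAP_Ubar hs) (MAP_Uhat hs) (MAP_Vbar hs).
have := balance_mulmx (Phat s k.+1) (MAP_svd_bar hs k) (Dhat_diag k)
  (D_diag k.+1).
(* In the V-step the SVD acts on the second factor, so the identity of products is used transposed
   and the regularizer with its arguments swapped. *)
move=> /(congr1 trmx); rewrite trmx_mul trmxK [RHS]trmx_mul trmxK => ->.
rewrite lerD2l [leLHS]regularizerC [leRHS]regularizerC.
exact (balance_regularizer (MAP_svd_bar hs k) (Dhat_diag k) (D_diag k.+1)
  (MAP_Phat hs k) (MAP_P hs k) (MAP_Q hs k) hlambda hmu (norm20_V k)).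
Qed.

Lemma gamma_term_ge0 (g : R) (a b : nat) (A : 'M[R]_(a, b)) :
  0 < g -> 0 <= g / 2 * frob_norm A ^+ 2.
Proof. by move=> g0; rewrite mulr_ge0 ?sqr_ge0// divr_ge0// ltW. Qed.

Lemma Uhat_Vhat_descent k :
  Phi f lambda mu (Uhat s k.+1) (Vhat s k.+1)
    + gamma1 s k / 2 * frob_norm (U s k.+1 - Ubar s k) ^+ 2
  <= Phi f lambda mu (Ubar s k) (Vbar s k).
Proof. by rewrite (le_trans _ (U_decrease k))// lerD2r Phi_Uhat_Vhat_le. Qed.

Lemma Ubar_Vbar_descent k :
  Phi f lambda mu (Ubar s k.+1) (Vbar s k.+1)
    + gamma2 s k / 2 * frob_norm (V s k.+1 - Vhat s k.+1) ^+ 2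
  <= Phi f lambda mu (Uhat s k.+1) (Vhat s k.+1).
Proof. by rewrite (le_trans _ (V_decrease k))// lerD2r Phi_Ubar_Vbar_le. Qed.

(** * Monotonicity and convergence of the objective values *)

Let bar k := Phi f lambda mu (Ubar s k) (Vbar s k).
(** The hatted iterates start at index 1, hence the shift; the two sequences interlace as
    [bar k.+1 <= hat k <= bar k]. *)
Let hat k := Phi f lambda mu (Uhat s k.+1) (Vhat s k.+1).

Lemma hat_le_bar k : hat k <= bar k.
Proof.
apply: le_trans (Uhat_Vhat_descent k).
by rewrite lerDl gamma_term_ge0// gamma1_gt0.
Qed.

Lemma bar_le_hat k : bar k.+1 <= hat k.
Proof.
apply: le_trans (Ubar_Vbar_descent k).
by rewrite lerDl gamma_term_ge0// gamma2_gt0.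
Qed.

Lemma nonincreasing_bar : nonincreasing_seq bar.
Proof.
by apply/nonincreasing_seqP => k;
  rewrite (le_trans (bar_le_hat k))// hat_le_bar.
Qed.

Lemma nonincreasing_hat : nonincreasing_seq hat.
Proof.
by apply/nonincreasing_seqP => k;
  rewrite (le_trans (hat_le_bar k.+1))// bar_le_hat.
Qed.

Lemma Phi_ge0 (A : 'M[R]_(n, r)) (B : 'M[R]_(m, r)) : 0 <= Phi f lambda mu A B.
Proof.
apply: addr_ge0 => //; apply: addr_ge0; apply: mulr_ge0 => //.
- by rewrite divr_ge0// ltW.
- by rewrite addr_ge0 ?sqr_ge0.
- exact: ltW.
Qed.

Lemma cvgn_bar : cvgn bar.
Proof.
apply: nonincreasing_is_cvgn nonincreasing_bar _.
by exists 0 => _ [k _ <-]; exact: Phi_ge0.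
Qed.

Lemma cvgn_hat : cvgn hat.
Proof.
apply: nonincreasing_is_cvgn nonincreasing_hat _.
by exists 0 => _ [k _ <-]; exact: Phi_ge0.
Qed.

(** * Boundedness of the iterates *)

Let M := Num.sqrt (2 / mu * bar 0%N).

Lemma bar_bounded k : `|Ubar s k| <= M /\ `|Vbar s k| <= M.
Proof. exact (Phi_bound hf_ge0 hlambda hmu (nonincreasing_bar (leq0n k))). Qed.

(** Besides the hatted pair, the mixed pairs [(U^{k+1}, Vbar^k)] and [(Uhat^{k+1}, V^{k+1})] occur
    as intermediate points of the descent chain, so [Phi] is at most [bar 0] at each of them. *)
Lemma iterates_bounded k :
  [/\ `|U s k.+1| <= M, `|V s k.+1| <= M, `|Uhat s k.+1| <= M
    & `|Vhat s k.+1| <= M].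
Proof.
have b0 : bar k <= bar 0%N := nonincreasing_bar (leq0n k).
have h0 : hat k <= bar 0%N := le_trans (hat_le_bar k) b0.
have U0 : Phi f lambda mu (U s k.+1) (Vbar s k) <= bar 0%N.
  rewrite (le_trans _ b0)// (le_trans _ (U_decrease k))//.
  by rewrite lerDl gamma_term_ge0// gamma1_gt0.
have V0 : Phi f lambda mu (Uhat s k.+1) (V s k.+1) <= bar 0%N.
  rewrite (le_trans _ h0)// (le_trans _ (V_decrease k))//.
  by rewrite lerDl gamma_term_ge0// gamma2_gt0.
have [? _] := Phi_bound hf_ge0 hlambda hmu U0.
have [_ ?] := Phi_bound hf_ge0 hlambda hmu V0.
by have [? ?] := Phi_bound hf_ge0 hlambda hmu h0.
Qed.

Lemma iterates_bounded_near :
  [bounded (U s k, V s k, Uhat s k, Vhat s k, Ubar s k, Vbar s k)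
     | k in [set k | (1 <= k)%N]].
Proof.
exists M; split; first exact: num_real.
move=> x /ltW Mx [//|k] _ /=; apply: le_trans Mx.
have [? ? ? ?] := iterates_bounded k; have [? ?] := bar_bounded k.+1.
by rewrite !prod_normE/= !ge_max/=; do ![apply/andP; split].
Qed.

Lemma bar_bounded_near : [bounded (Ubar s k, Vbar s k) | k in [set: nat]].
Proof.
exists M; split; first exact: num_real.
move=> x /ltW Mx k _ /=; apply: le_trans Mx.
by rewrite prod_normE/= ge_max; apply/andP; exact: bar_bounded.
Qed.

(** * Stabilization of the supports *)

Lemma col_support_stationary : exists K, forall k, (K <= k)%N ->
  [/\ col_support (U s k.+1) = col_support (D s k),
      col_support (Dhat s k.+1) = col_support (D s k),
      col_support (V s k.+1) = col_support (D s k)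
    & col_support (D s k.+1) = col_support (D s k)].
Proof.
have [k|K HK] := @nonincreasing_nat_stationary (fun k => norm20 (D s k)).
  rewrite (leq_trans (norm20_D k))// (leq_trans (norm20_V k))//.
  by rewrite (leq_trans (norm20_Dhat k))// norm20_U.
exists K => k Kk.
have Dk : norm20 (D s k.+1) = norm20 (D s k) by rewrite !HK// ltnW.
(* These four inequalities form a chain from [norm20 (D s k.+1)] up to [norm20 (D s k)]; its ends
   agree, so all counts in it are equal. *)
have h1 := norm20_U k; have h2 := norm20_Dhat k.
have h3 := norm20_V k; have h4 := norm20_D k.
have eDhat : col_support (Dhat s k.+1) = col_support (D s k).
  apply: col_support_sorted_diag; [exact: MAP_Dhat hs k|exact: D_sorted|].
  apply/eqP; rewrite eqn_leq (leq_trans h2 h1)/= -Dk.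
  exact: leq_trans h4 h3.
split=> //.
- apply/eqP; rewrite eqEcard col_support_U/= -/(norm20 _) -/(norm20 _) -Dk.
  by rewrite (leq_trans h4)// (leq_trans h3).
- apply/eqP; rewrite eqEcard -{1}eDhat col_support_V/= -/(norm20 _) -/(norm20 _).
  by rewrite -Dk.
- by apply: col_support_sorted_diag => //; exact: D_sorted.
Qed.

End Run.

Unset Implicit Arguments.

Theorem proposition4p2 (R : realType) (n m r : nat)
    (hnm : (n <= m)%N) (hr1 : (1 <= r)%N) (hrn : (r <= n)%N)
    (f : 'M[R]_(n, m) -> R) (Lf lambda mu : R)
    (hf_ge0 : forall X, 0 <= f X)
    (hf_diff : forall X, differentiable f X)
    (hf_lip : forall X Y,
      frob_norm (grad f X - grad f Y) <= Lf * frob_norm (X - Y))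
    (hlambda : 0 < lambda) (hmu : 0 < mu)
    (rho gamma1_low gamma2_low : R) (s : map_run R n m r)
    (hs : generated_by_MAP f Lf lambda mu rho gamma1_low gamma2_low s) :
  (* (i) *)
  ((forall k : nat,
      Phi f lambda mu (Ubar s k) (Vbar s k)
      >= Phi f lambda mu (Uhat s k.+1) (Vhat s k.+1)
         + gamma1 s k / 2 * frob_norm (U s k.+1 - Ubar s k) ^+ 2
      /\
      Phi f lambda mu (Uhat s k.+1) (Vhat s k.+1)
         + gamma1 s k / 2 * frob_norm (U s k.+1 - Ubar s k) ^+ 2
      >= Phi f lambda mu (Ubar s k.+1) (Vbar s k.+1)
         + gamma1 s k / 2 * frob_norm (U s k.+1 - Ubar s k) ^+ 2
         + gamma2 s k / 2 * frob_norm (V s k.+1 - Vhat s k.+1) ^+ 2)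
   /\ nonincreasing_seq (fun k => Phi f lambda mu (Ubar s k) (Vbar s k))
   /\ cvgn (fun k => Phi f lambda mu (Ubar s k) (Vbar s k))
   /\ nonincreasing_seq
        (fun k => Phi f lambda mu (Uhat s k.+1) (Vhat s k.+1))
   /\ cvgn (fun k => Phi f lambda mu (Uhat s k.+1) (Vhat s k.+1)))
  /\
  (* (ii) *)
  ([bounded (U s k, V s k, Uhat s k, Vhat s k, Ubar s k, Vbar s k)
     | k in [set k | (1 <= k)%N]]
   /\ [bounded (Ubar s k, Vbar s k) | k in [set: nat]])
  /\
  (* (iii) *)
  (exists kbar : nat, (1 <= kbar)%N /\
     forall k : nat, (kbar <= k)%N ->
       col_support (V s k) = col_support (U s k)
       /\ col_support (U s k) = col_support (Uhat s k)
       /\ col_support (Uhat s k) = col_support (Vhat s k)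
       /\ col_support (Vhat s k) = col_support (Vbar s k)
       /\ col_support (Vbar s k) = col_support (Ubar s k)
       /\ col_support (Ubar s k) = col_support (Ubar s k.+1)).
Proof.
split; [split; [|split; [|split; [|split]]]|split; [split|]].
- move=> k; split; first exact: Uhat_Vhat_descent hs k.
  by rewrite addrAC lerD2r; exact: Ubar_Vbar_descent hs k.
- exact: nonincreasing_bar hs.
- exact: cvgn_bar hs.
- exact: nonincreasing_hat hs.
- exact: cvgn_hat hs.
- exact: iterates_bounded_near hs.
- exact: bar_bounded_near hs.
- have [K HK] := col_support_stationary hlambda hmu hs.
  (* The supports at index [k.+1] are controlled by stationarity at [k], whence the shift by one;
     the last equality, which reaches [k.+2], uses stationarity at [k.+1] as well. *)
  exists K.+1; split=> // -[//|k]; rewrite ltnS => Kk.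
  have [UD DhD VD DD] := HK k Kk; have [_ _ _ DD'] := HK k.+1 (leqW Kk).
  rewrite (col_support_Uhat hs) (col_support_Vhat hs) (col_support_Vbar hs).
  by rewrite !(col_support_Ubar hs) UD DhD VD DD' DD.
Qed.
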